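(* Let $T_d^2$ be the complete binary tree of depth $d$. Then $$c_1 d\le b_e(T_d^2)\le d\qquad\text{and}\qquad c_2 d\le b_v(T_d^2)\le d,$$ where $c_1$ and $c_2$ are constants.
   Context: Graphs are finite, simple and undirected. For a graph $G=(V,E)$ and $S\subseteq V$, let $\delta(S,G)=\{(u,v)\in E: u\in S,\ v\in V-S\}$ be the edge boundary and $\phi(S,G)=\{v\in V-S:\exists u\in S\text{ such that }(u,v)\in E\}$ the vertex boundary. For an integer $i$ with $1\le i\le |V|$ let $b_e(i,G)=\min_{S\subseteq V,\ |S|=i}|\delta(S,G)|$ and $b_v(i,G)=\min_{S\subseteq V,\ |S|=i}|\phi(S,G)|$. The edge and vertex isoperimetric peaks are $b_e(G)=\max_{1\le i\le |V|}b_e(i,G)$ and $b_v(G)=\max_{1\le i\le |V|}b_v(i,G)$. The depth of a rooted tree is the number of nodes on the longest path starting from the root and ending at a leaf. The complete binary tree $T_d^2$ of depth $d$ is the rooted tree in which every non-leaf node has exactly 2 children and every root-to-leaf path has exactly $d$ nodes.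
   Formalization: The constants are taken positive and the two lower bounds are stated only for depth d at least 2, because for d = 1 the tree is a single node and both peaks are 0; the upper bounds hold for all d at least 1. *)

(* Defs.v *)
From mathcomp Require Import all_boot.

Set Implicit Arguments.
Unset Strict Implicit.
Unset Printing Implicit Defensive.

Record sgraph := SGraph {
  vertex :> finType;
  adj : rel vertex;
  adj_sym : symmetric adj;
  adj_irr : irreflexive adj }.

Section Isoperimetry.
Variable G : sgraph.
Implicit Types (S : {set G}) (i : nat).

(* Pairs are oriented from S to its complement, so every undirected edge that
   leaves S is counted exactly once. *)
Definition edge_boundary S : {set G * G} :=
  [set p | [&& adj p.1 p.2, p.1 \in S & p.2 \notin S]].

Definition vertex_boundary S : {set G} :=
  [set v | (v \notin S) && [exists u in S, adj u v]].

(* An arbitrary set of i vertices: the starting point required by [arg min].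
   The values below do not depend on it, see edge_isoP and vertex_isoP. *)
Definition iset i : {set G} := [set x in take i (enum G)].

Definition edge_iso i : nat :=
  #|edge_boundary [arg min_(S < iset i | #|S| == i) #|edge_boundary S|]|.

Definition vertex_iso i : nat :=
  #|vertex_boundary [arg min_(S < iset i | #|S| == i) #|vertex_boundary S|]|.

Definition edge_peak : nat := \max_(1 <= i < #|G|.+1) edge_iso i.

Definition vertex_peak : nat := \max_(1 <= i < #|G|.+1) vertex_iso i.

Lemma card_iset i : i <= #|G| -> #|iset i| == i.
Proof.
move=> le_i; rewrite cardsE; apply/eqP.
have /card_uniqP -> : uniq (take i (enum G)) by rewrite take_uniq ?enum_uniq.
by rewrite size_takel // -cardE.
Qed.

Lemma edge_isoP i : i <= #|G| ->
  (exists2 S : {set G}, #|S| = i & #|edge_boundary S| = edge_iso i) /\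
  (forall S : {set G}, #|S| = i -> edge_iso i <= #|edge_boundary S|).
Proof.
move=> /card_iset Hi; rewrite /edge_iso; case: arg_minnP => // S /eqP cS minS.
by split=> [|S' /eqP]; [exists S | exact: minS].
Qed.

Lemma vertex_isoP i : i <= #|G| ->
  (exists2 S : {set G}, #|S| = i & #|vertex_boundary S| = vertex_iso i) /\
  (forall S : {set G}, #|S| = i -> vertex_iso i <= #|vertex_boundary S|).
Proof.
move=> /card_iset Hi; rewrite /vertex_iso; case: arg_minnP => // S /eqP cS minS.
by split=> [|S' /eqP]; [exists S | exact: minS].
Qed.

End Isoperimetry.

Section CompleteBinaryTree.
Variable d : nat.

(* A node is the word of left/right turns leading to it from the root, the
   empty word; the words have length < d because depth counts nodes. *)
Definition btree_node : finType := {k : 'I_d & k.-tuple bool}.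

Definition address (u : btree_node) : seq bool := val (tagged u).

Definition child (u v : btree_node) : bool :=
  [exists b : bool, address v == rcons (address u) b].

Definition btree_adj (u v : btree_node) : bool := child u v || child v u.

Lemma btree_adj_sym : symmetric btree_adj.
Proof. by move=> u v; rewrite /btree_adj orbC. Qed.

Lemma btree_adj_irr : irreflexive btree_adj.
Proof.
move=> u; rewrite /btree_adj orbb; apply/existsP=> -[b /eqP /(congr1 size)].
by rewrite size_rcons => /n_Sn.
Qed.

Definition btree : sgraph := SGraph btree_adj_sym btree_adj_irr.

Lemma size_address (u : btree_node) : size (address u) < d.
Proof. by case: u => k t; rewrite /address size_tuple ltn_ord. Qed.

Lemma address_inj : injective address.
Proof.
move=> [k t] [l s]; rewrite /address /= => e.
have ekl : k = l by apply: val_inj; rewrite /= -(size_tuple t) e size_tuple.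
by subst l; congr existT; apply: val_inj.
Qed.

Lemma address_surj (w : seq bool) : size w < d -> exists u, address u = w.
Proof. by move=> lt_w; exists (existT _ (Ordinal lt_w) (in_tuple w)). Qed.

End CompleteBinaryTree.

(* In the one-node tree both peaks vanish, so a positive linear lower bound in
   d can only hold from d = 2 on. *)
Lemma card_btree1 : #|btree 1| = 1.
Proof.
have [u _] := @address_surj 1 [::] isT.
apply: (eq_card1 (x := u)) => v; apply/esym/eqP/address_inj.
by move: (size_address u) (size_address v); rewrite !ltnS !leqn0 => /nilP-> /nilP->.
Qed.

Lemma peaks_btree1 : edge_peak (btree 1) = 0 /\ vertex_peak (btree 1) = 0.
Proof.
have tot (S : {set btree 1}) : #|S| = 1 -> S = [set: btree 1].
  by move=> cS; apply/eqP; rewrite eqEcard subsetT cS cardsT card_btree1.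
rewrite /edge_peak /vertex_peak card_btree1 !big_nat1.
split.
  have [[S /tot -> <-] _] := @edge_isoP (btree 1) 1 (eq_leq (esym card_btree1)).
  by apply: eq_card0 => p; rewrite !inE /= andbF.
have [[S /tot -> <-] _] := @vertex_isoP (btree 1) 1 (eq_leq (esym card_btree1)).
by apply: eq_card0 => v; rewrite !inE.
Qed.

(* Main.v *)
Require Import Defs.
From mathcomp Require Import all_boot all_order all_algebra.
From mathcomp Require Import reals.
From mathcomp Require Import zify.
Import Order.TTheory GRing.Theory Num.Theory.

Set Implicit Arguments.
Unset Strict Implicit.
Unset Printing Implicit Defensive.

(** A set S of nodes is counted against its parent relation: call a node v a
    flip when exactly one of v and its parent lies in S, with the convention
    that the root has a virtual parent outside S.  The non-root flips are the
    edges of the boundary of S, so the number of flips is the size of the edge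
    boundary, plus one if the root is in S (flips_mem_word).

    Upper bound.  Every i below 2^d is the size of a set with at most d flips
    (exists_few_flips): if i fits in one subtree of the root, recurse there;
    otherwise fill the other subtree completely, which costs the single flip
    at its root, and recurse with what remains.  The vertex boundary is never
    larger than the edge boundary.

    Lower bound.  Let x_k be the number of nodes of S at level k.  A level with
    x_k = 2 x_(k-1) may be free of flips, and in general level k has at least
    |x_k - 2 x_(k-1)| of them.  Unrolling the recurrence writes |S| plus a
    small error as a sum of signed powers of 2, at most one for each flip.  So
    |S| is hard to realize when its binary digits alternate: with |S| = 2 c_L and
    c_L = (4^L - 1) / 3, whose binary expansion is 0101...01, at least L / 5
    flips are needed (comb_cost, comb_flips).  Taking L about d / 2 makes the
    edge boundary linear in d, and since degrees are at most 3 the vertex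
    boundary has at least a third of that size (edge_le_degree).  The loss of
    one flip at the root is absorbed by the fact that the boundary of a
    non-trivial set in a connected graph is not empty.  This gives the
    constant 1/90 for both peaks. *)

(** * Sums over the nodes of the tree *)

Fixpoint layer (k : nat) : seq (seq bool) :=
  if k is k'.+1 then
    [seq true :: w | w <- layer k'] ++ [seq false :: w | w <- layer k']
  else [:: [::]].

Definition words (d : nat) : seq (seq bool) :=
  flatten [seq layer k | k <- iota 0 d].

Lemma mem_layer k w : (w \in layer k) = (size w == k).
Proof.
have cons_inj (c : bool) : injective (cons c) by move=> s t [].
elim: k w => [|k IHk] [|b w] //=; rewrite mem_cat.
  by apply/negP=> /orP[] /mapP[].
have off (c : bool) (t : seq (seq bool)) :
    c :: w \notin [seq ~~ c :: v | v <- t].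
  by apply/mapP=> -[v _ []]; case: c.
case: b; rewrite (mem_map (cons_inj _)) IHk.
  by rewrite (negbTE (off true _)) orbF.
by rewrite (negbTE (off false _)).
Qed.

Lemma uniq_layer k : uniq (layer k).
Proof.
elim: k => //= k IHk; rewrite cat_uniq !map_inj_uniq ?IHk; try by move=> s t [].
by rewrite andbT; apply/hasPn=> _ /mapP[v _ ->]; apply/mapP=> -[].
Qed.

Lemma mem_words d w : (w \in words d) = (size w < d).
Proof.
apply/flatten_mapP/idP=> [[k]|lt_w].
  by rewrite mem_iota mem_layer => lt_k /eqP->.
by exists (size w); rewrite ?mem_iota ?mem_layer.
Qed.

Lemma words_rcons d : words d.+1 = words d ++ layer d.
Proof. by rewrite /words -addn1 iotaD map_cat flatten_cat /= cats0. Qed.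

Lemma uniq_words d : uniq (words d).
Proof.
elim: d => // d IHd; rewrite words_rcons cat_uniq IHd uniq_layer andbT.
apply/hasPn=> w; rewrite mem_layer => /eqP <-.
by rewrite mem_words ltnn.
Qed.

(** The two ways of extending a word match the two inductions on the tree:
    adding the first letter splits the tree at the root into its two subtrees,
    adding the last letter goes from a level to the next one. *)
Lemma sum_layer_cons k (F : seq bool -> nat) :
  \sum_(w <- layer k.+1) F w =
  \sum_(w <- layer k) F (true :: w) + \sum_(w <- layer k) F (false :: w).
Proof. by rewrite /= big_cat !big_map. Qed.

Lemma sum_layer_rcons k (F : seq bool -> nat) :
  \sum_(w <- layer k.+1) F w =
  \sum_(w <- layer k) (F (rcons w true) + F (rcons w false)).
Proof.
elim: k F => [|k IHk] F; first by rewrite big_cons !big_seq1.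
by rewrite [RHS]sum_layer_cons sum_layer_cons !IHk.
Qed.

Lemma sum_words d (F : seq bool -> nat) :
  \sum_(w <- words d) F w = \sum_(k < d) \sum_(w <- layer k) F w.
Proof.
elim: d => [|d IHd]; first by rewrite big_ord0 big_nil.
by rewrite words_rcons big_cat IHd big_ord_recr.
Qed.

Lemma sum_words_cons d (F : seq bool -> nat) :
  \sum_(w <- words d.+1) F w =
  F [::] + (\sum_(w <- words d) F (true :: w) +
            \sum_(w <- words d) F (false :: w)).
Proof.
rewrite !sum_words big_ord_recl /= big_seq1 -big_split; congr (_ + _).
by apply: eq_bigr => k _; apply: sum_layer_cons.
Qed.

Lemma size_words d : size (words d) = (2 ^ d).-1.
Proof.
rewrite -sum1_size; elim: d => [|d IHd]; first by rewrite big_nil.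
by rewrite sum_words_cons IHd expnS; have := expn_gt0 2 d; lia.
Qed.

Lemma sum_btree d (F : seq bool -> nat) :
  \sum_(u : btree d) F (address u) = \sum_(w <- words d) F w.
Proof.
rewrite -big_enum -(big_map (@address d) xpredT F); apply: perm_big.
apply: uniq_perm; rewrite ?uniq_words //.
  by rewrite (map_inj_uniq (@address_inj d)) enum_uniq.
move=> w; rewrite mem_words; apply/mapP/idP => [[u _ ->]|/address_surj[u <-]].
  exact: size_address.
by exists u; rewrite ?mem_enum.
Qed.

Lemma card_btree d : #|btree d| = (2 ^ d).-1.
Proof. by rewrite -sum1_card (sum_btree d (fun=> 1)) sum1_size size_words. Qed.

(** * Flips and the upper bound *)

(** The value [false] at the root is the convention that makes the tree behave
    like a subtree hanging below a node outside the set. *)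
Definition parent_mem (f : pred (seq bool)) : pred (seq bool) :=
  fun w => if w is b :: w' then f (belast b w') else false.

Lemma parent_mem_rcons f w b : parent_mem f (rcons w b) = f w.
Proof. by case: w => // c w; rewrite /= belast_rcons. Qed.

Lemma parent_mem_cons f b w : f [::] = false ->
  parent_mem f (b :: w) = parent_mem (fun v => f (b :: v)) w.
Proof. by case: w. Qed.

Definition flips (d : nat) (f : pred (seq bool)) : nat :=
  \sum_(w <- words d) (f w != parent_mem f w).

(** The bound survives the induction because flips count the edge above the
    root: a full subtree costs exactly one flip, and the other subtree can use
    the remaining d. *)
Lemma exists_few_flips d i : i < 2 ^ d ->
  exists2 f : pred (seq bool), \sum_(w <- words d) f w = i & flips d f <= d.
Proof.
elim: d i => [|d IHd] i lt_i.
  by exists xpred0; rewrite /flips big_nil //; move: lt_i; case: i.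
have [i_full|i_small] := eqVneq i (2 ^ d.+1).-1.
  exists xpredT; first by rewrite i_full -size_words -sum1_size.
  rewrite /flips sum_words_cons /= !big1 // => -[|b w] _ //.
(* One subtree is either empty or full, whichever leaves in [i - n1] a size
   that the other subtree can realize. *)
have [f1 [n1 [sum_f1 n1i flips_f1]]] : exists (f1 : pred (seq bool)) n1,
    [/\ \sum_(w <- words d) f1 w = n1, n1 <= i < n1 + 2 ^ d
      & flips d f1 <= 1].
  have [lt_d|ge_d] := ltnP i (2 ^ d).
    exists xpred0, 0; split=> //; first by rewrite big1.
    by rewrite /flips big1 // => -[|b w].
  exists xpredT, (2 ^ d).-1; split.
  - by rewrite sum1_size size_words.
  - by move: lt_i i_small ge_d; rewrite expnS; lia.
  - case: d {lt_i i_small ge_d IHd} => [|d]; first by rewrite /flips big_nil.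
    by rewrite /flips sum_words_cons /= !big1 // => -[|b w].
have [|f2 n2 c2] := IHd (i - n1); first by lia.
pose f w := if w is b :: w' then (if b then f1 w' else f2 w') else false.
exists f; first by rewrite sum_words_cons /= n2; lia.
rewrite /flips sum_words_cons add0n.
under eq_bigr do rewrite parent_mem_cons //.
under [X in _ + X]eq_bigr do rewrite parent_mem_cons //.
rewrite /= -/(flips d f1) -/(flips d f2); lia.
Qed.

(** * Sizes with alternating binary digits need many flips *)

Local Open Scope ring_scope.

(** This is (4^L - 1) / 3, written 0101...01 in binary. *)
Definition comb (L : nat) : int := iter L (fun z => 1 + 4 * z) 0.

Lemma le_comb L : L%:Z <= comb L.
Proof. by elim: L => // L IHL; rewrite /comb /= -/(comb L); lia. Qed.

Lemma three_comb L : 3 * comb L = (4 ^ L)%N%:Z - 1.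
Proof. by elim: L => // L IHL; rewrite /comb /= -/(comb L) expnS; lia. Qed.

(** Read [x j.+1 - 2 * x j] as a digit appended to the binary numeral [x j]:
    the lemma bounds from below the total weight of signed digits that write a
    number close to [comb L].  Removing two digits a, b from comb L + T leaves
    comb (L - 1) + t with 4 t = 1 + T - 2 a - b.  Either a digit or T is
    non-zero, since 1 is not divisible by 4; and the division by 4 shrinks the
    error enough for the weight 2 |T| to pay for the induction step. *)
Lemma comb_cost (x : nat -> int) (L k : nat) (T : int) :
  x 0%N = 0 -> x k = comb L + T ->
  L%:Z <= 4 * (\sum_(j < k) `|x j.+1 - 2 * x j|) + 2 * `|T|.
Proof.
move=> x0; elim: L k T => [|L IHL] k T xk.
  by apply: addr_ge0; rewrite ?mulr_ge0 ?sumr_ge0.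
case: k xk => [|[|k]] xk.
- by rewrite big_ord0; have := le_comb L.+1; lia.
- by rewrite big_ord1 /=; have := le_comb L.+1; lia.
rewrite 2!big_ord_recr /=; move: xk; rewrite /comb /= -/(comb L) => xk.
have /IHL : x k = comb L + (x k - comb L) by lia.
set S1 := \sum_(j < k) _.
have step : 1 + 2 * `|x k - comb L| <=
    4 * (`|x k.+1 - 2 * x k| + `|x k.+2 - 2 * x k.+1|) + 2 * `|T|.
  by move: (x k.+2) (x k.+1) (x k) (comb L) xk; lia.
move: step; lia.
Qed.

(** The sum of all levels telescopes to twice the last level, minus the total
    of the digits; this total is an error that [comb_cost] tolerates. *)
Lemma comb_cost_sum (x : nat -> int) (L d : nat) :
  x 0%N = 0 -> \sum_(k < d) x k.+1 = 2 * comb L ->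
  L%:Z <= 5 * \sum_(j < d) `|x j.+1 - 2 * x j|.
Proof.
move=> x0 sx; pose A := \sum_(j < d) (x j.+1 - 2 * x j).
have twice : 2 * x d = 2 * comb L + A.
  rewrite -sx /A; elim: d {sx A} => [|d IHd]; first by rewrite !big_ord0 x0.
  by rewrite !big_ord_recr /= addrACA -IHd; lia.
have leA : `|A| <= \sum_(j < d) `|x j.+1 - 2 * x j| by apply: ler_norm_sum.
have /(comb_cost x0) : x d = comb L + (x d - comb L) by lia.
by lia.
Qed.

(** Compare each pair of siblings with their parent: the difference is at most
    the number of flips among the two. *)
Lemma layer_flips (f : pred (seq bool)) k :
  `| (\sum_(w <- layer k.+1) f w)%N%:Z - 2 * (\sum_(w <- layer k) f w)%N%:Z |
    <= (\sum_(w <- layer k.+1) (f w != parent_mem f w))%N%:Z.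
Proof.
rewrite !sum_layer_rcons.
elim: (layer k) => [|w s IHs]; first by rewrite !big_nil.
rewrite !big_cons !parent_mem_rcons; move: IHs.
move: (\sum_(j <- s) _)%N (\sum_(j <- s) _)%N (\sum_(j <- s) _)%N => A B C.
by case: (f _) (f _) (f _) => [] [] []; rewrite ?eqxx /=; lia.
Qed.

Lemma comb_flips d (f : pred (seq bool)) (L : nat) :
  (\sum_(w <- words d) f w)%N%:Z = 2 * comb L -> (L <= 5 * flips d f)%N.
Proof.
move=> sf.
(* The index is shifted by one: [x 0] is the level of the virtual parent. *)
pose x k : int := if k is k'.+1 then (\sum_(w <- layer k') f w)%N else 0.
have sx : \sum_(k < d) x k.+1 = 2 * comb L.
  by rewrite -sf sum_words (big_morph Posz PoszD erefl).
rewrite -lez_nat; apply: le_trans (comb_cost_sum erefl sx) _.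
rewrite PoszM ler_wpM2l // /flips sum_words (big_morph Posz PoszD erefl).
apply: ler_sum => -[[|k] lt_k] _ /=; last exact: layer_flips.
by rewrite !big_seq1 /=; case: (f _).
Qed.

Local Open Scope nat_scope.

(** * Boundaries in the tree *)

Lemma child_rcons d (u v : btree d) b :
  address v = rcons (address u) b -> child u v.
Proof. by move=> e; apply/existsP; exists b; apply/eqP. Qed.

Definition mem_word d (S : {set btree d}) : pred (seq bool) :=
  fun w => [exists u in S, address u == w].

Lemma mem_word_address d (S : {set btree d}) u :
  mem_word S (address u) = (u \in S).
Proof.
apply/existsP/idP => [[v /andP[vS /eqP/address_inj <-]] //|uS].
by exists u; rewrite uS /=.
Qed.

Lemma card_mem_word d (S : {set btree d}) :
  #|S| = \sum_(w <- words d) mem_word S w.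
Proof.
rewrite -sum_btree -sum1_card big_mkcond; apply: eq_bigr => u _.
by rewrite mem_word_address; case: (u \in S).
Qed.

(** By default the root is its own parent here, unlike in [parent_mem]. *)
Definition parent d (v : btree d) : btree d := odflt v [pick u | child u v].

Lemma address_parent d (v : btree d) b w :
  address v = rcons w b -> address (parent v) = w.
Proof.
move=> ev; rewrite /parent; case: pickP => [u /existsP[c /eqP]|no_parent] /=.
  by rewrite ev => /rcons_inj[].
have [u eu] : exists u : btree d, address u = w.
  apply: address_surj.
  by have := size_address v; rewrite ev size_rcons => /ltnW.
by have := no_parent u; rewrite (@child_rcons _ u v b) ?ev ?eu.
Qed.

Lemma parent_mem_address d (S : {set btree d}) v : address v != [::] ->
  parent_mem (mem_word S) (address v) = (parent v \in S).
Proof.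
case/lastP E: (address v) => [//|w b] _.
by rewrite parent_mem_rcons -(address_parent E) mem_word_address.
Qed.

Lemma child_parent d (u v : btree d) :
  child u v -> (u = parent v) /\ address v != [::].
Proof.
move=> /existsP[b /eqP e]; split; last by rewrite e; case: (address u).
by apply: address_inj; rewrite (address_parent e).
Qed.

Lemma parent_child d (v : btree d) : address v != [::] -> child (parent v) v.
Proof.
case/lastP E: (address v) => [//|w b] _.
by apply: (@child_rcons _ _ _ b); rewrite (address_parent E).
Qed.

Lemma child_asym d (u v : btree d) : child u v -> child v u -> False.
Proof.
move=> /existsP[b /eqP e] /existsP[c /eqP]; rewrite e => /(congr1 size).
by rewrite !size_rcons; lia.
Qed.

(** A boundary edge is determined by its lower endpoint, which is a flip other
    than the root; its orientation is determined by which end lies in S. *)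
Lemma flips_mem_word d (S : {set btree d}) : 0 < d ->
  flips d (mem_word S) = #|edge_boundary S| + mem_word S [::].
Proof.
move=> d_gt0; have [r er] := @address_surj d [::] d_gt0.
pose D := [set v : btree d |
  (address v != [::]) && ((v \in S) != (parent v \in S))].
pose g v := if v \in S then (v, parent v) else (parent v, v).
have -> : edge_boundary S = g @: D.
  apply/setP=> -[u v]; rewrite inE /=; apply/and3P/imsetP.
    case=> /orP[] uv uS vS; have [e nz] := child_parent uv.
      by exists v; rewrite ?inE /g -?e ?uS ?(negbTE vS) ?nz.
    by exists u; rewrite ?inE /g -?e ?uS ?(negbTE vS) ?nz.
  case=> w; rewrite inE /g => /andP[/parent_child cw].
  case wS: (w \in S); case pS: (parent w \in S) => //= _ [-> ->];
  by rewrite wS pS /btree_adj cw ?orbT.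
rewrite card_in_imset; last first.
  move=> u v; rewrite !inE /g.
  move=> /andP[/parent_child cu _] /andP[/parent_child cv _].
  (* With opposite orientations u and v would each be the child of the other. *)
  case: ifP => uS; case: ifP => vS [] // e1 e2; exfalso.
    by apply: (child_asym cu); rewrite e2 e1.
  by apply: (child_asym cu); rewrite e1 e2.
rewrite /flips -sum_btree (bigD1 r) //= er addnC.
congr (_ + _); last by case: mem_word.
rewrite -sum1_card [RHS]big_mkcond [RHS](bigD1 r) //= inE er eqxx add0n.
apply: eq_bigr => v vr; rewrite inE.
have nz : address v != [::] by rewrite -er (inj_eq (@address_inj d)).
by rewrite nz mem_word_address parent_mem_address //; case: (_ != _).
Qed.

Lemma vertex_le_edge (G : sgraph) (S : {set G}) :
  #|vertex_boundary S| <= #|edge_boundary S|.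
Proof.
apply: leq_trans (leq_imset_card snd (edge_boundary S)).
apply: subset_leq_card; apply/subsetP => v; rewrite inE.
move=> /andP[vS /existsP[u /andP[uS uv]]].
by apply/imsetP; exists (u, v); rewrite // inE /= uv uS vS.
Qed.

Lemma edge_le_degree (G : sgraph) (k : nat) (S : {set G}) :
  (forall v : G, #|[set u | adj u v]| <= k) ->
  #|edge_boundary S| <= k * #|vertex_boundary S|.
Proof.
move=> deg; rewrite -sum1_card.
rewrite (partition_big snd (mem (vertex_boundary S))) /=; last first.
  move=> [u v]; rewrite !inE /= => /and3P[uv uS ->] /=.
  by apply/existsP; exists u; rewrite uS.
rewrite mulnC -sum_nat_const; apply: leq_sum => v _; rewrite sum1_card.
apply: leq_trans (deg v).
apply: leq_trans (leq_imset_card (fun u => (u, v)) [set u | adj u v]).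
apply: subset_leq_card; apply/subsetP=> -[u v']; rewrite unfold_in /= inE /=.
move=> /andP[/and3P[uv _ _] /eqP e].
by apply/imsetP; exists u; rewrite ?inE -?e.
Qed.

Lemma btree_degree d (v : btree d) : #|[set u : btree d | adj u v]| <= 3.
Proof.
rewrite cardE -(size_map (@address d)).
apply: (@uniq_leq_size _ _ [:: address (parent v);
  rcons (address v) true; rcons (address v) false]).
  by rewrite (map_inj_uniq (@address_inj d)) enum_uniq.
move=> _ /mapP[u + ->]; rewrite mem_enum !inE => /orP[].
  by case/child_parent=> <- _; rewrite eqxx.
by case/existsP=> -[] /eqP->; rewrite eqxx ?orbT.
Qed.

(** The tree is connected: membership propagates from the root along edges. *)
Lemma no_edge_boundary d (S : {set btree d}) :
  edge_boundary S = set0 -> S = set0 \/ S = setT.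
Proof.
move=> eb0.
have step (u v : btree d) : child u v -> (u \in S) = (v \in S).
  move=> uv; case uS: (u \in S); case vS: (v \in S) => //.
    by have := in_set0 (u, v); rewrite -eb0 inE /= /btree_adj uv uS vS.
  by have := in_set0 (v, u); rewrite -eb0 inE /= /btree_adj uv uS vS orbT.
have same (u v : btree d) : address u = [::] -> (v \in S) = (u \in S).
  move=> eu; elim/last_ind: {v}(address v) {-2}v (erefl (address v)).
    move=> v ev.
    by have -> : v = u by apply: (@address_inj d); rewrite ev.
  move=> w b IHw v ev.
  rewrite -(IHw (parent v) (address_parent ev)); apply/esym/step/parent_child.
  by rewrite ev; case: (w).
have [->|/set0Pn[v vS]] := eqVneq S set0; [by left | right].
have [u eu] := @address_surj d [::] (leq_ltn_trans (leq0n _) (size_address v)).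
by apply/setP=> w; rewrite inE (same u w eu) -(same u v eu) vS.
Qed.

(** * Bounds on the peaks *)

Lemma edge_iso_le d i : 0 < d -> i <= #|btree d| -> edge_iso (btree d) i <= d.
Proof.
move=> d_gt0 le_i.
have [|f sum_f flips_f] := @exists_few_flips d i.
  by move: le_i; rewrite card_btree; have := expn_gt0 2 d; lia.
pose S := [set u : btree d | f (address u)].
have SE : {in words d, mem_word S =1 f}.
  move=> w; rewrite mem_words => /address_surj[u <-].
  by rewrite mem_word_address inE.
have cS : #|S| = i.
  by rewrite card_mem_word -sum_f; apply: eq_big_seq => w /SE ->.
have [_ /(_ S cS) le_S] := edge_isoP le_i; apply: leq_trans le_S _.
apply: leq_trans flips_f; have <- : flips d (mem_word S) = flips d f.
  apply: eq_big_seq => w w_d; rewrite (SE w w_d); congr (nat_of_bool (_ != _)).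
  case/lastP: w w_d => [//|w b].
  rewrite !parent_mem_rcons mem_words size_rcons => /ltnW.
  by rewrite -mem_words => /SE.
by rewrite flips_mem_word // leq_addr.
Qed.

Lemma vertex_iso_le_edge_iso (G : sgraph) i : i <= #|G| ->
  vertex_iso G i <= edge_iso G i.
Proof.
move=> le_i; have [[S cS <-] _] := edge_isoP le_i.
have [_ /(_ S cS)] := vertex_isoP le_i.
by move/leq_trans; apply; apply: vertex_le_edge.
Qed.

Lemma vertex_peak_le_edge_peak (G : sgraph) : vertex_peak G <= edge_peak G.
Proof.
rewrite /vertex_peak /edge_peak !big_seq.
elim/big_ind2: _ => // [m1 n1 m2 n2 le1 le2|i].
  by rewrite geq_max !leq_max le1 le2 orbT.
by rewrite mem_index_iota => /andP[_]; apply: vertex_iso_le_edge_iso.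
Qed.

Lemma edge_peak_le d : 0 < d -> edge_peak (btree d) <= d.
Proof.
move=> d_gt0; apply/bigmax_leqP_seq => i.
rewrite mem_index_iota => /andP[_ le_i] _.
exact: edge_iso_le.
Qed.

(** The size with L = d./2 digit pairs forces L <= 5 (m + 1), where m is the
    size of the edge boundary.  Since m is positive this gives L <= 10 m, and
    then d <= 3 L and m <= 3 #|vertex_boundary S| yield the factor 90. *)
Lemma vertex_peak_ge d : 1 < d -> d <= 90 * vertex_peak (btree d).
Proof.
move=> d_gt1; pose L := d./2.
pose i := absz (2 * comb L)%R.
have iE : i%:Z = (2 * comb L)%R.
  by rewrite /i gez0_abs //; have := le_comb L; lia.
have pow : 4 ^ L <= 2 ^ d.
  rewrite -[4]/(2 ^ 2) -expnM leq_exp2l //.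
  by have := odd_double_half d; rewrite -muln2; lia.
have i_gt0 : 0 < i by have := le_comb L; move: iE; rewrite /L; lia.
have i_lt : i < #|btree d|.
  by rewrite card_btree; have := three_comb L; move: pow iE; lia.
apply: (@leq_trans (90 * vertex_iso (btree d) i)); last first.
  by rewrite leq_mul2l leq_bigmax_seq // mem_index_iota i_gt0 ltnS ltnW.
have [[S cS <-] _] := vertex_isoP (ltnW i_lt).
have le3 := edge_le_degree S (@btree_degree d).
have eb_gt0 : 0 < #|edge_boundary S|.
  rewrite card_gt0; apply/eqP => /no_edge_boundary[] eS; move: cS i_gt0 i_lt.
    by rewrite eS cards0 => <-.
  by rewrite eS cardsT => <-; rewrite ltnn.
have leL : L <= 5 * flips d (mem_word S).
  by apply: comb_flips; rewrite -card_mem_word cS.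
rewrite flips_mem_word in leL; last exact: ltnW.
have := odd_double_half d; have := leq_b1 (mem_word S [::]); rewrite -/L -muln2.
by have := leq_b1 (odd d); lia.
Qed.

Local Open Scope ring_scope.
Unset Implicit Arguments.

Theorem corollary1 (R : realType) :
  exists c1 c2 : R,
    [/\ 0 < c1, 0 < c2 &
      forall d : nat, (1 <= d)%N ->
        [/\ (edge_peak (btree d) <= d)%N,
            (vertex_peak (btree d) <= d)%N &
            (2 <= d)%N ->
              c1 * d%:R <= (edge_peak (btree d))%:R /\
              c2 * d%:R <= (vertex_peak (btree d))%:R]].
Proof.
exists (90%:R^-1), (90%:R^-1); split; rewrite ?invr_gt0 ?ltr0n // => d d_gt0.
have peaks := vertex_peak_le_edge_peak (btree d).
have upper := edge_peak_le d_gt0.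
split=> //; first exact: leq_trans upper.
move=> /vertex_peak_ge lower.
have scale (m : nat) : (vertex_peak (btree d) <= m)%N ->
    90%:R^-1 * d%:R <= m%:R :> R.
  move=> le_m; rewrite mulrC ler_pdivrMr ?ltr0n // mulrC -natrM ler_nat.
  by apply: leq_trans lower _; rewrite leq_mul2l le_m.
by split; apply: scale.
Qed.
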